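(* Let $v\ge 2$ be an integer and let $p$ be the smallest prime divisor of $v$. Then any cyclic $(v,k,\lambda)$ difference set, i.e. any $(v,k,\lambda)$ difference set in the cyclic group $\mathbb{Z}_v$, extends at least to dimension $p$.
   Context: A $(v,k,\lambda)$ difference set in an additively written group $G$ of order $v$ is a $k$-subset $D\subseteq G$ such that every $g\in G\setminus\{0\}$ can be written as $g=a-b$ with $a,b\in D$ in exactly $\lambda$ ways. An $n$-dimensional $(v,k,\lambda)$ difference set in $G$ is a $k$-subset $E\subseteq G^n$ of $n$-tuples such that for every pair of coordinates $1\le x<y\le n$ the set $\{e_x-e_y\mid e\in E\}$ is a $(v,k,\lambda)$ difference set in $G$. A $(v,k,\lambda)$ difference set $D\subseteq G$ extends to dimension $n$ if there is an $n$-dimensional $(v,k,\lambda)$ difference set $E\subseteq G^n$ and two distinct coordinates $x\ne y$ such that $D=\{e_x-e_y\mid e\in E\}$. ''Extends at least to dimension $p$'' means that it extends to dimension $p$ (and possibly further). *)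

(* Defs.v *)
From HB Require Import structures.
From mathcomp Require Import all_boot all_order all_algebra.

Set Implicit Arguments.
Unset Strict Implicit.
Unset Printing Implicit Defensive.

Import GRing.Theory.

Local Open Scope ring_scope.

(* finZmodType is commutative; the definitions are only used for cyclic
   groups. *)
Definition difference_set (G : finZmodType) (v k lambda : nat)
    (D : {set G}) : Prop :=
  [/\ #|G| = v, #|D| = k &
      forall g : G, g != 0 ->
        #|[set ab in setX D D | g == ab.1 - ab.2]| = lambda].

Definition coord_diff (G : finZmodType) (n : nat) (E : {set n.-tuple G})
    (x y : 'I_n) : {set G} :=
  [set tnth e x - tnth e y | e in E].

Definition ndim_difference_set (G : finZmodType) (n v k lambda : nat)
    (E : {set n.-tuple G}) : Prop :=
  #|E| = k /\
  forall x y : 'I_n, (x < y)%N -> difference_set v k lambda (coord_diff E x y).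

(* The coordinates x and y may come in either order, unlike above. *)
Definition extends_to_dim (G : finZmodType) (v k lambda : nat) (D : {set G})
    (n : nat) : Prop :=
  exists E : {set n.-tuple G},
    ndim_difference_set v k lambda E /\
    exists x y : 'I_n, x != y /\ D = coord_diff E x y.

(* Main.v *)
Require Import Defs.
From HB Require Import structures.
From mathcomp Require Import all_boot all_order all_algebra.

(** The set of arithmetic progressions (0, d, 2d, ..., (p-1)d) with d in D is
    the required extension: coordinates y < x differ by (x-y)d, and since
    0 < x - y < p the factor x - y is coprime to v, so multiplication by it is
    an automorphism of the cyclic group and preserves difference sets. *)

Set Implicit Arguments.
Unset Strict Implicit.
Unset Printing Implicit Defensive.

Import GRing.Theory.

(** A gcd above 1 would be a divisor of [n] that is at least [pdiv n], yet it is at most [m]. *)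
Lemma coprime_lt_pdiv (n m : nat) :
  0 < n -> 0 < m -> m < pdiv n -> coprime n m.
Proof.
move=> n_gt0 m_gt0 m_lt; rewrite /coprime eqn_leq gcdn_gt0 n_gt0 andbT leqNgt.
apply/negP=> /pdiv_min_dvd/(_ (dvdn_gcdl n m)); rewrite leqNgt => /negP; apply.
exact: leq_ltn_trans (dvdn_leq m_gt0 (dvdn_gcdr n m)) m_lt.
Qed.

Local Open Scope ring_scope.

Lemma difference_set_imset (G : finZmodType) (f : G -> G) (v k lambda : nat)
    (D : {set G}) :
  {morph f : x y / x - y} -> injective f ->
  difference_set v k lambda D -> difference_set v k lambda (f @: D).
Proof.
move=> fB f_inj [cardG cardD hD]; split=> //; first by rewrite card_imset.
(* [G] is finite, so [f] is bijective and [g] can be taken as [f h]; [F] then matches the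
   representations of [h] with those of [f h]. *)
move=> g; have [f' fK f'K] := injF_bij f_inj; rewrite -(f'K g); move: (f' g) => h.
have f0 : f 0 = 0 by rewrite -[in LHS](subrr 0) fB subrr.
rewrite -{1}f0 (inj_eq f_inj) => /hD <-.
pose F (ab : G * G) := (f ab.1, f ab.2).
have F_inj : injective F.
  by move=> [a b] [c d]; rewrite /F /= => -[/f_inj-> /f_inj->].
rewrite -[RHS](card_imset _ F_inj); apply: eq_card => -[a b]; rewrite !inE /=.
apply/andP/imsetP => [[/andP[/imsetP[a' Da ->] /imsetP[b' Db ->]]]|].
  by rewrite -fB (inj_eq f_inj) => h_eq; exists (a', b'); rewrite // !inE Da Db.
move=> [[a' b']]; rewrite !inE /= => /andP[/andP[Da Db] /eqP->] [-> ->].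
by rewrite !imset_f // fB.
Qed.

(** In the ring ['Z_v] the map is multiplication by [n%:R], a unit by coprimality. *)
Lemma mulrn_Zp_inj (v n : nat) :
  (1 < v)%N -> coprime v n -> injective (fun d : 'Z_v => d *+ n).
Proof.
move=> v_gt1 co_vn d1 d2; rewrite -[LHS]mulr_natr -[RHS]mulr_natr.
by apply: mulIr; rewrite unitZpE.
Qed.

Definition progression (G : zmodType) (n : nat) (d : G) : n.-tuple G :=
  [tuple d *+ i | i < n].

Lemma coord_diff_progression (G : finZmodType) (n : nat) (D : {set G})
    (x y : 'I_n) :
  coord_diff (progression n @: D) x y = [set d *+ x - d *+ y | d in D].
Proof.
rewrite /coord_diff -imset_comp; apply: eq_imset => d /=.
by rewrite !tnth_mktuple.
Qed.

Theorem corollary4p8 (v k lambda : nat) (hv : (1 < v)%N) (D : {set 'Z_v})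
    (hD : difference_set v k lambda D) :
  extends_to_dim v k lambda D (pdiv v).
Proof.
have p_gt1 : (1 < pdiv v)%N by exact/prime_gt1/pdiv_prime.
pose i0 := Ordinal (ltnW p_gt1); pose i1 := Ordinal p_gt1.
exists (progression (pdiv v) @: D); split; last first.
  (* Coordinates 1 and 0 give back [D], as they differ by [d - 0]. *)
  exists i1, i0; split=> //; rewrite coord_diff_progression /= -[LHS]imset_id.
  by apply: eq_imset => d; rewrite mulr1n mulr0n subr0.
split=> [|x y lt_xy].
  (* A progression is determined by its entry [d] at coordinate 1. *)
  have [_ <- _] := hD; apply: card_imset => d1 d2.
  by move/(congr1 (fun e => tnth e i1)); rewrite !tnth_mktuple.
rewrite coord_diff_progression; apply: difference_set_imset hD.
  by move=> a b /=; rewrite !mulrnBl !opprD !opprK addrACA.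
have co : coprime v (y - x).
  apply: coprime_lt_pdiv; [exact: ltnW | by rewrite subn_gt0 |].
  exact: leq_ltn_trans (leq_subr x y) (ltn_ord y).
(* Since [x < y], the difference is written as the opposite of [a *+ (y - x)], which keeps the
   natural subtraction from truncating. *)
move=> a b; rewrite -[LHS]opprB -[RHS]opprB -!mulrnBr ?(ltnW lt_xy) //.
by move/oppr_inj/(mulrn_Zp_inj hv co).
Qed.
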